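(* Let $(X,\eta,\mu)$ be a monoid in $\mathbf{Span}$, where $\eta$ is represented by a span $\bullet\leftarrow E\xrightarrow{s_0^0}X$ and $\mu$ is represented by a span $X\times X\xleftarrow{(d_2^2,d_0^2)}M\xrightarrow{d_1^2}X$. Let $d_0^1,d_1^1:X\to E$ and $s_0^1,s_1^1:X\to M$ be the maps determined by the unit axiom as described in the context. Then the sets $X_0=E$, $X_1=X$, $X_2=M$, with face maps $d_0^1,d_1^1,d_0^2,d_1^2,d_2^2$ and degeneracy maps $s_0^0,s_0^1,s_1^1$, form a $2$-truncated simplicial set.
   Context: Spans. A span from a set $X$ to a set $Y$ is a triple $(A,f_1,f_2)$ with $A$ a set and maps $f_1:A\to X$, $f_2:A\to Y$. Two spans $(A,f_1,f_2)$, $(A',f_1',f_2')$ from $X$ to $Y$ are isomorphic if there is a bijection $\phi:A\to A'$ with $f_1'\phi=f_1$, $f_2'\phi=f_2$. The category $\mathbf{Span}$ has sets as objects and isomorphism classes of spans as morphisms; the composite of $(A,f_1,f_2)$ from $X$ to $Y$ followed by $(B,g_1,g_2)$ from $Y$ to $Z$ is the pullback $\{(a,b)\in A\times B: f_2(a)=g_1(b)\}$ with maps $(a,b)\mapsto f_1(a)$ and $(a,b)\mapsto g_2(b)$. The identity $\mathbf{1}$ of $X$ is represented by $(X,\mathrm{id},\mathrm{id})$. $\mathbf{Span}$ is monoidal under Cartesian product (of sets and of spans), with unit object a one-point set $\bullet$; the canonical identifications $(X\times Y)\times Z=X\times(Y\times Z)$, $\bullet\times X=X=X\times\bullet$ are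 used implicitly. A monoid in $\mathbf{Span}$ is a set $X$ with morphisms $\eta:\bullet\to X$ and $\mu:X\times X\to X$ in $\mathbf{Span}$ such that $\mu\circ(\mathbf{1}\times\eta)=\mu\circ(\eta\times\mathbf{1})=\mathbf{1}$ (unit axiom) and $\mu\circ(\mathbf{1}\times\mu)=\mu\circ(\mu\times\mathbf{1})$ (associativity). The maps $d_0^1,s_1^1,d_1^1,s_0^1$. Let $P=\{(x,e,m)\in X\times E\times M: x=d_2^2m,\ s_0^0e=d_0^2m\}$, the pullback computing $\mu\circ(\mathbf{1}\times\eta)$. Since $\mu\circ(\mathbf{1}\times\eta)=\mathbf{1}$, there is a unique bijection $X\to P$, which has the form $x\mapsto(x,d_0^1(x),s_1^1(x))$ with $d_1^2(s_1^1(x))=x$; this defines $d_0^1:X\to E$ and $s_1^1:X\to M$. Similarly let $Q=\{(e,x,m)\in E\times X\times M: s_0^0e=d_2^2m,\ x=d_0^2m\}$, the pullback computing $\mu\circ(\eta\times\mathbf{1})$. Since $\mu\circ(\eta\times\mathbf{1})=\mathbf{1}$, there is a unique bijection $X\to Q$ of the form $x\mapsto(d_1^1(x),x,s_0^1(x))$ with $d_1^2(s_0^1(x))=x$; this defines $d_1^1:X\to E$ and $s_0^1:X\to M$. (In both cases, ''unique bijection'' means the unique isomorphism from the identity span of $X$ to the composite span.) A $2$-truncated simplicial set consists of sets $X_0,X_1,X_2$, face maps $d_i^q:X_q\to X_{q-1}$ ($0\le i\le q$, $q=1,2$) and degeneracy maps $s_i^q:X_q\to X_{q+1}$ ($0\le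 i\le q$, $q=0,1$) satisfying, whenever both sides are defined, $d_i^{q-1}d_j^q=d_{j-1}^{q-1}d_i^q$ for $i<j$; $s_i^{q+1}s_j^q=s_{j+1}^{q+1}s_i^q$ for $i\le j$; and $d_i^{q+1}s_j^q=s_{j-1}^{q-1}d_i^q$ for $i<j$, $=\mathrm{id}$ for $i\in\{j,j+1\}$, $=s_j^{q-1}d_{i-1}^q$ for $i>j+1$. *)

(* Defs.v *)
From mathcomp Require Import all_boot.
From mathcomp Require Import boolp.

Set Implicit Arguments.
Unset Strict Implicit.
Unset Printing Implicit Defensive.

Record span (X Y : Type) := Span {
  apex : Type;
  lleg : apex -> X;
  rleg : apex -> Y }.

Arguments Span {X Y apex} lleg rleg.

Record is_span_isom (X Y : Type) (s t : span X Y) (phi : apex s -> apex t) :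
    Prop := IsSpanIsom {
  span_isom_bij : bijective phi;
  span_isom_lleg : forall a, lleg (phi a) = lleg a;
  span_isom_rleg : forall a, rleg (phi a) = rleg a }.

Definition span_isomorphic (X Y : Type) (s t : span X Y) : Prop :=
  exists phi : apex s -> apex t, is_span_isom phi.

Definition graph (X Y : Type) (f : X -> Y) : span X Y := Span id f.

(* [span_comp s t] is [s] followed by [t]. *)
Definition span_comp (X Y Z : Type) (s : span X Y) (t : span Y Z) : span X Z :=
  @Span X Z {p : apex s * apex t | rleg p.1 = lleg p.2}
    (fun p => lleg (sval p).1) (fun p => rleg (sval p).2).

Definition span_prod (X Y X' Y' : Type) (s : span X Y) (t : span X' Y') :
    span (X * X') (Y * Y') :=
  @Span (X * X') (Y * Y') (apex s * apex t)
    (fun p => (lleg p.1, lleg p.2)) (fun p => (rleg p.1, rleg p.2)).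

Lemma span_isomorphic_refl (X Y : Type) (s : span X Y) : span_isomorphic s s.
Proof. by exists id; split=> //; exists id. Qed.

Lemma span_isomorphic_sym (X Y : Type) (s t : span X Y) :
  span_isomorphic s t -> span_isomorphic t s.
Proof.
move=> [phi [[psi phiK psiK] hl hr]]; exists psi; split; first by exists phi.
  by move=> b; rewrite -hl psiK.
by move=> b; rewrite -hr psiK.
Qed.

Lemma span_isomorphic_trans (X Y : Type) (s t u : span X Y) :
  span_isomorphic s t -> span_isomorphic t u -> span_isomorphic s u.
Proof.
move=> [f [bf fl fr]] [g [bg gl gr]]; exists (g \o f); split.
- exact: bij_comp.
- by move=> a /=; rewrite gl fl.
- by move=> a /=; rewrite gr fr.
Qed.

Lemma sig_inj (T : Type) (P : T -> Prop) (u v : {x | P x}) :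
  sval u = sval v -> u = v.
Proof. exact: eq_sig_hprop (fun x => @Prop_irrelevance (P x)) _ _. Qed.

Lemma span_comp_isomorphic (X Y Z : Type) (s s' : span X Y) (t t' : span Y Z) :
  span_isomorphic s s' -> span_isomorphic t t' ->
  span_isomorphic (span_comp s t) (span_comp s' t').
Proof.
move=> [f [[f' fK f'K] fl fr]] [g [[g' gK g'K] gl gr]].
have H (p : apex (span_comp s t)) :
    rleg (f (sval p).1, g (sval p).2).1 = lleg (f (sval p).1, g (sval p).2).2.
  by rewrite /= fr gl; exact: (svalP p).
have H' (p : apex (span_comp s' t')) :
    rleg (f' (sval p).1, g' (sval p).2).1 = lleg (f' (sval p).1, g' (sval p).2).2.
  by rewrite /= -fr -gl f'K g'K; exact: (svalP p).
pose P' p := rleg (s := s') p.1 = lleg (s := t') p.2.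
pose P p := rleg (s := s) p.1 = lleg (s := t) p.2.
exists (fun p => exist P' (f (sval p).1, g (sval p).2) (H p)); split.
- exists (fun p => exist P (f' (sval p).1, g' (sval p).2) (H' p)).
  + by move=> [[a b] ab]; apply: sig_inj; rewrite /= fK gK.
  + by move=> [[a b] ab]; apply: sig_inj; rewrite /= f'K g'K.
- by move=> [[a b] ab] /=; rewrite fl.
- by move=> [[a b] ab] /=; rewrite gr.
Qed.

Lemma span_prod_isomorphic (X Y X' Y' : Type)
    (s s' : span X Y) (t t' : span X' Y') :
  span_isomorphic s s' -> span_isomorphic t t' ->
  span_isomorphic (span_prod s t) (span_prod s' t').
Proof.
move=> [f [[f' fK f'K] fl fr]] [g [[g' gK g'K] gl gr]].
exists (fun p => (f p.1, g p.2)); split.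
- exists (fun p => (f' p.1, g' p.2)).
  + by move=> [a b]; rewrite /= fK gK.
  + by move=> [a b]; rewrite /= f'K g'K.
- by move=> [a b] /=; rewrite fl gl.
- by move=> [a b] /=; rewrite fr gr.
Qed.

(* A morphism of the category Span: an isomorphism class of spans. *)
Record hom (X Y : Type) := Hom {
  hom_mem : span X Y -> Prop;
  hom_memP : exists s, forall t, hom_mem t <-> span_isomorphic s t }.

Definition hom_class (X Y : Type) (s : span X Y) : hom X Y :=
  @Hom X Y (span_isomorphic s) (ex_intro _ s (fun t => iff_refl _)).

Definition hom_repr (X Y : Type) (f : hom X Y) : span X Y :=
  sval (cid (hom_memP f)).

Lemma hom_class_eq (X Y : Type) (s t : span X Y) :
  hom_class s = hom_class t <-> span_isomorphic s t.
Proof.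
split=> [e|st].
  have : hom_mem (hom_class t) t by exact: span_isomorphic_refl.
  by rewrite -e.
rewrite /hom_class; move: (ex_intro _ s _) (ex_intro _ t _).
have -> : span_isomorphic s = span_isomorphic t.
  apply/funext => u; apply/propext; split; apply: span_isomorphic_trans => //.
  exact: span_isomorphic_sym.
by move=> p q; congr Hom; exact: Prop_irrelevance.
Qed.

Lemma hom_reprK (X Y : Type) (f : hom X Y) : hom_class (hom_repr f) = f.
Proof.
rewrite /hom_repr; case: cid => s /=; case: f => P hP /= Ps.
rewrite /hom_class; move: (ex_intro _ s _).
have <- : P = span_isomorphic s by apply/funext => t; apply/propext.
by move=> p; congr Hom; exact: Prop_irrelevance.
Qed.

(* [hom_comp f g] is [f] followed by [g]; by [hom_comp_class] and
   [hom_prod_class] below the operations do not depend on representatives. *)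
Definition hom_comp (X Y Z : Type) (f : hom X Y) (g : hom Y Z) : hom X Z :=
  hom_class (span_comp (hom_repr f) (hom_repr g)).

Definition hom_prod (X Y X' Y' : Type) (f : hom X Y) (g : hom X' Y') :
    hom (X * X') (Y * Y') :=
  hom_class (span_prod (hom_repr f) (hom_repr g)).

Definition hom_id (X : Type) : hom X X := hom_class (graph (@id X)).

Lemma hom_comp_class (X Y Z : Type) (s : span X Y) (t : span Y Z) :
  hom_comp (hom_class s) (hom_class t) = hom_class (span_comp s t).
Proof.
by apply/hom_class_eq/span_comp_isomorphic; apply/hom_class_eq; exact: hom_reprK.
Qed.

Lemma hom_prod_class (X Y X' Y' : Type) (s : span X Y) (t : span X' Y') :
  hom_prod (hom_class s) (hom_class t) = hom_class (span_prod s t).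
Proof.
by apply/hom_class_eq/span_prod_isomorphic; apply/hom_class_eq; exact: hom_reprK.
Qed.

(* The canonical identifications X = X * unit, X = unit * X and
   (X * Y) * Z = X * (Y * Z), as morphisms of Span. *)
Definition to_prod_unit (X : Type) : hom X (X * unit) :=
  hom_class (graph (fun x => (x, tt))).

Definition to_unit_prod (X : Type) : hom X (unit * X) :=
  hom_class (graph (fun x => (tt, x))).

Definition prod_assoc (X Y Z : Type) : hom (X * Y * Z) (X * (Y * Z)) :=
  hom_class (graph (fun p => (p.1.1, (p.1.2, p.2)))).

Record is_monoid (X : Type) (eta : hom unit X) (mu : hom (X * X) X) : Prop :=
  IsMonoid {
  monoid_unitr :
    hom_comp (to_prod_unit X) (hom_comp (hom_prod (hom_id X) eta) mu)
    = hom_id X;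
  monoid_unitl :
    hom_comp (to_unit_prod X) (hom_comp (hom_prod eta (hom_id X)) mu)
    = hom_id X;
  monoid_assoc :
    hom_comp (prod_assoc X X X) (hom_comp (hom_prod (hom_id X) mu) mu)
    = hom_comp (hom_prod mu (hom_id X)) mu }.

Definition unit_span (X E : Type) (s00 : E -> X) : span unit X :=
  Span (fun _ => tt) s00.

Definition mult_span (X M : Type) (d02 d12 d22 : M -> X) : span (X * X) X :=
  Span (fun m => (d22 m, d02 m)) d12.

(* Below, [dij] and [sij] stand for d_i^j and s_i^j. *)

(* The pullback {(x, e, m) | x = d_2^2 m, s_0^0 e = d_0^2 m} computing
   mu o (1 x eta), see [unitr_span_comp]. *)
Definition unitr_span (X E M : Type) (s00 : E -> X) (d02 d12 d22 : M -> X) :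
    span X X :=
  @Span X X {p : X * E * M | p.1.1 = d22 p.2 /\ s00 p.1.2 = d02 p.2}
    (fun p => (sval p).1.1) (fun p => d12 (sval p).2).

(* The pullback {(e, x, m) | s_0^0 e = d_2^2 m, x = d_0^2 m} computing
   mu o (eta x 1), see [unitl_span_comp]. *)
Definition unitl_span (X E M : Type) (s00 : E -> X) (d02 d12 d22 : M -> X) :
    span X X :=
  @Span X X {q : E * X * M | s00 q.1.1 = d22 q.2 /\ q.1.2 = d02 q.2}
    (fun q => (sval q).1.2) (fun q => d12 (sval q).2).

Definition unitr_maps (X E M : Type) (s00 : E -> X) (d02 d12 d22 : M -> X)
    (d01 : X -> E) (s11 : X -> M) : Prop :=
  exists2 phi : apex (graph (@id X)) -> apex (unitr_span s00 d02 d12 d22),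
    is_span_isom phi & forall x : X, sval (phi x) = (x, d01 x, s11 x).

Definition unitl_maps (X E M : Type) (s00 : E -> X) (d02 d12 d22 : M -> X)
    (d11 : X -> E) (s01 : X -> M) : Prop :=
  exists2 psi : apex (graph (@id X)) -> apex (unitl_span s00 d02 d12 d22),
    is_span_isom psi & forall x : X, sval (psi x) = (d11 x, x, s01 x).

Lemma unitr_span_comp (X E M : Type) (s00 : E -> X) (d02 d12 d22 : M -> X) :
  hom_comp (to_prod_unit X)
    (hom_comp (hom_prod (hom_id X) (hom_class (unit_span s00)))
              (hom_class (mult_span d02 d12 d22)))
  = hom_class (unitr_span s00 d02 d12 d22).
Proof.
rewrite hom_prod_class !hom_comp_class; apply/hom_class_eq.
apply: span_isomorphic_sym.
have H1 (p : apex (unitr_span s00 d02 d12 d22)) :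
    rleg (s := span_prod (graph (@id X)) (unit_span s00)) (sval p).1
    = lleg (s := mult_span d02 d12 d22) (sval p).2.
  by case: p => [[[x e] m]] /= [-> ->].
pose g p : apex (span_comp (span_prod (graph (@id X)) (unit_span s00))
                           (mult_span d02 d12 d22)) :=
  exist _ ((sval p).1, (sval p).2) (H1 p).
pose h p : apex (span_comp (graph (fun x : X => (x, tt))) (span_comp
    (span_prod (graph (@id X)) (unit_span s00)) (mult_span d02 d12 d22))) :=
  exist _ ((sval p).1.1, g p) erefl.
exists h; split => //.
have H2 (q : apex (span_comp (graph (fun x : X => (x, tt))) (span_comp
    (span_prod (graph (@id X)) (unit_span s00)) (mult_span d02 d12 d22)))) :
    let p := sval (sval q).2 in
    p.1.1 = d22 p.2 /\ s00 p.1.2 = d02 p.2.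
  by case: q => [[x [[[y e] m] /= [-> ->]]]].
exists (fun q => exist _ (sval (sval q).2) (H2 q)).
  by move=> [[[x e] m] hp]; apply: sig_inj.
move=> [[x [[[y e] m] hm]] hx]; apply: sig_inj => /=.
by congr pair; [case: hx | exact: sig_inj].
Qed.

Lemma unitl_span_comp (X E M : Type) (s00 : E -> X) (d02 d12 d22 : M -> X) :
  hom_comp (to_unit_prod X)
    (hom_comp (hom_prod (hom_class (unit_span s00)) (hom_id X))
              (hom_class (mult_span d02 d12 d22)))
  = hom_class (unitl_span s00 d02 d12 d22).
Proof.
rewrite hom_prod_class !hom_comp_class; apply/hom_class_eq.
apply: span_isomorphic_sym.
have H1 (p : apex (unitl_span s00 d02 d12 d22)) :
    rleg (s := span_prod (unit_span s00) (graph (@id X))) (sval p).1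
    = lleg (s := mult_span d02 d12 d22) (sval p).2.
  by case: p => [[[x e] m]] /= [-> ->].
pose g p : apex (span_comp (span_prod (unit_span s00) (graph (@id X)))
                           (mult_span d02 d12 d22)) :=
  exist _ ((sval p).1, (sval p).2) (H1 p).
pose h p : apex (span_comp (graph (fun x : X => (tt, x))) (span_comp
    (span_prod (unit_span s00) (graph (@id X))) (mult_span d02 d12 d22))) :=
  exist _ ((sval p).1.2, g p) erefl.
exists h; split => //.
have H2 (q : apex (span_comp (graph (fun x : X => (tt, x))) (span_comp
    (span_prod (unit_span s00) (graph (@id X))) (mult_span d02 d12 d22)))) :
    let p := sval (sval q).2 in
    s00 p.1.1 = d22 p.2 /\ p.1.2 = d02 p.2.
  by case: q => [[x [[[y e] m] /= [-> ->]]]].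
exists (fun q => exist _ (sval (sval q).2) (H2 q)).
  by move=> [[[x e] m] hp]; apply: sig_inj.
move=> [[x [[[y e] m] hm]] hx]; apply: sig_inj => /=.
by congr pair; [case: hx | exact: sig_inj].
Qed.

(* The unit axiom determines the maps d_0^1, s_1^1, d_1^1, s_0^1. *)
Lemma unitr_maps_unique (X E M : Type) (s00 : E -> X) (d02 d12 d22 : M -> X) :
  is_monoid (hom_class (unit_span s00)) (hom_class (mult_span d02 d12 d22)) ->
  exists! f : (X -> E) * (X -> M), unitr_maps s00 d02 d12 d22 f.1 f.2.
Proof.
move=> [H _ _]; move: H; rewrite unitr_span_comp => /esym/hom_class_eq.
move=> [phi iphi]; have [[psi phiK psiK] hl _] := iphi.
exists ((fun x : X => (sval (phi x)).1.2), (fun x : X => (sval (phi x)).2)).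
split=> [|[d01 s11] /= [phi' [_ hl' _] e']].
  exists phi => //= x; move: (hl x) => /=.
  by case: (sval (phi x)) => [[a b] c] /= ->.
have phiE x : phi x = phi' x.
  by rewrite -[RHS]psiK; congr phi; rewrite -[RHS](hl (psi _)) psiK hl'.
by congr pair; apply/funext => x; rewrite phiE e'.
Qed.

Lemma unitl_maps_unique (X E M : Type) (s00 : E -> X) (d02 d12 d22 : M -> X) :
  is_monoid (hom_class (unit_span s00)) (hom_class (mult_span d02 d12 d22)) ->
  exists! f : (X -> E) * (X -> M), unitl_maps s00 d02 d12 d22 f.1 f.2.
Proof.
move=> [_ H _]; move: H; rewrite unitl_span_comp => /esym/hom_class_eq.
move=> [phi iphi]; have [[psi phiK psiK] hl _] := iphi.
exists ((fun x : X => (sval (phi x)).1.1), (fun x : X => (sval (phi x)).2)).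
split=> [|[d11 s01] /= [phi' [_ hl' _] e']].
  exists phi => //= x; move: (hl x) => /=.
  by case: (sval (phi x)) => [[a b] c] /= ->.
have phiE x : phi x = phi' x.
  by rewrite -[RHS]psiK; congr phi; rewrite -[RHS](hl (psi _)) psiK hl'.
by congr pair; apply/funext => x; rewrite phiE e'.
Qed.

(* All instances, for indices in the range of a 2-truncated simplicial set, of
     d_i d_j = d_(j-1) d_i                          for i < j,
     s_i s_j = s_(j+1) s_i                          for i <= j,
     d_i s_j = s_(j-1) d_i, id, or s_j d_(i-1)
       for i < j, for i = j or i = j + 1, and for i > j + 1, respectively. *)
Record is_2truncated_simplicial_set (X0 X1 X2 : Type)
    (d01 d11 : X1 -> X0) (d02 d12 d22 : X2 -> X1)
    (s00 : X0 -> X1) (s01 s11 : X1 -> X2) : Prop := Is2TruncatedSimplicialSet {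
  simp_d0_d1 : forall m, d01 (d12 m) = d01 (d02 m);
  simp_d0_d2 : forall m, d01 (d22 m) = d11 (d02 m);
  simp_d1_d2 : forall m, d11 (d22 m) = d11 (d12 m);
  simp_s0_s0 : forall e, s01 (s00 e) = s11 (s00 e);
  simp_d0_s0_deg0 : forall e, d01 (s00 e) = e;
  simp_d1_s0_deg0 : forall e, d11 (s00 e) = e;
  simp_d0_s0 : forall x, d02 (s01 x) = x;
  simp_d1_s0 : forall x, d12 (s01 x) = x;
  simp_d2_s0 : forall x, d22 (s01 x) = s00 (d11 x);
  simp_d0_s1 : forall x, d02 (s11 x) = s00 (d01 x);
  simp_d1_s1 : forall x, d12 (s11 x) = x;
  simp_d2_s1 : forall x, d22 (s11 x) = x }.

(* Main.v *)
Require Import Defs.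
From mathcomp Require Import all_boot.

(** Think of [m : M] as a triangle witnessing that [d12 m] is a product of
    [d22 m] and [d02 m], and of [s00 e] as a unit.  The simplicial identities
    then say that each [x] has exactly one left unit [d11 x] and exactly one
    right unit [d01 x], and that these behave under products as sources and
    targets of arrows do.

    The unit axioms contribute more than the existence of [s01] and [s11]:
    since the maps into the two pullbacks are surjective, a triangle with a
    unit as one factor is degenerate ([unitl_maps_degenerate],
    [unitr_maps_degenerate]).  The triangle [s11 (s00 e)] has the unit [s00 e]
    as left factor, so it is also of the form [s01 _]; comparing faces gives
    the identities on [s00 e].

    The three identities between faces come from associativity, of which only
    the trace on relations matters ([mult_rel_assoc]): for a product w = xy, each
    of the products (x1)y, x(y1) and (1x)y can be bracketed the other way.  The
    rebracketed product again contains a factor equal to that unit, and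
    uniqueness of left or right units identifies it with the unit of the
    element that it now multiplies. *)

Set Implicit Arguments.
Unset Strict Implicit.
Unset Printing Implicit Defensive.

(** * Relations underlying spans *)

Definition span_rel (X Y : Type) (s : span X Y) (x : X) (y : Y) : Prop :=
  exists2 a, lleg (s := s) a = x & rleg a = y.

Lemma span_rel_isomorphic (X Y : Type) (s t : span X Y) (x : X) (y : Y) :
  span_isomorphic s t -> span_rel s x y <-> span_rel t x y.
Proof.
suff imp (u v : span X Y) :
    span_isomorphic u v -> span_rel u x y -> span_rel v x y.
  by move=> st; split; apply: imp => //; exact: span_isomorphic_sym.
by move=> [phi [_ hl hr]] [a <- <-]; exists (phi a).
Qed.

Lemma span_rel_comp (X Y Z : Type) (s : span X Y) (t : span Y Z) x z :
  span_rel (span_comp s t) x z <-> exists2 y, span_rel s x y & span_rel t y z.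
Proof.
split=> [[[[a b] /= ab] /= <- <-]|[y [a <- ay] [b bb <-]]].
  by exists (rleg a); [exists a | exists b].
have ab : rleg a = lleg b by rewrite ay bb.
by exists (exist (fun p => rleg p.1 = lleg p.2) (a, b) ab).
Qed.

Lemma span_rel_prod (X Y X' Y' : Type) (s : span X Y) (t : span X' Y') p q :
  span_rel (span_prod s t) p q <-> span_rel s p.1 q.1 /\ span_rel t p.2 q.2.
Proof.
case: p q => [x x'] [y y'] /=; split=> [[[a b] /= [<- <-] [<- <-]]|].
  by split; [exists a | exists b].
by move=> [[a <- <-] [b <- <-]]; exists (a, b).
Qed.

Lemma span_rel_graph (X Y : Type) (f : X -> Y) x y :
  span_rel (graph f) x y <-> f x = y.
Proof. by split=> [[a /= <-]|<-] //; exists x. Qed.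

(** * The partial multiplication and its units *)

Section Monoid.

Variables (X E M : Type) (s00 : E -> X) (d02 d12 d22 : M -> X).

Notation mult_rel x y w := (span_rel (mult_span d02 d12 d22) (x, y) w).

Lemma mult_relE m : mult_rel (d22 m) (d02 m) (d12 m).
Proof. by exists m. Qed.

(** An isomorphism of spans preserves the underlying relation, and taking the
    underlying relation turns composites and products of spans into those of
    relations; so the equality of the two composites in Span gives this. *)
Lemma mult_rel_assoc x y z w :
  is_monoid (hom_class (unit_span s00)) (hom_class (mult_span d02 d12 d22)) ->
  (exists2 v, mult_rel y z v & mult_rel x v w) <->
  (exists2 u, mult_rel x y u & mult_rel u z w).
Proof.
move=> [_ _]; rewrite /prod_assoc /hom_id !hom_prod_class !hom_comp_class.
move=> /hom_class_eq/(span_rel_isomorphic (x, y, z) w) assoc.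
split=> [[v yzv xvw]|[u xyu uzw]].
  have /assoc/span_rel_comp[[u z']] : span_rel (span_comp
      (graph (fun p => (p.1.1, (p.1.2, p.2)))) (span_comp
        (span_prod (graph (@id X)) (mult_span d02 d12 d22))
        (mult_span d02 d12 d22))) (x, y, z) w.
    apply/span_rel_comp; exists (x, (y, z)); first exact/span_rel_graph.
    apply/span_rel_comp; exists (x, v) => //.
    by apply/span_rel_prod; split=> //; exact/span_rel_graph.
  by move=> /span_rel_prod[/= xyu /span_rel_graph/= <-] uzw; exists u.
have /assoc/span_rel_comp[p /span_rel_graph/= <-] : span_rel (span_comp
    (span_prod (mult_span d02 d12 d22) (graph (@id X)))
    (mult_span d02 d12 d22)) (x, y, z) w.
  apply/span_rel_comp; exists (u, z) => //.
  by apply/span_rel_prod; split=> //; exact/span_rel_graph.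
move=> /span_rel_comp[[x' v]].
by move=> /span_rel_prod[/= /span_rel_graph/= <- yzv] xvw; exists v.
Qed.

Section RightUnit.

Variables (d01 : X -> E) (s11 : X -> M).
Hypothesis unitr : unitr_maps s00 d02 d12 d22 d01 s11.

Lemma unitr_maps_faces x :
  [/\ d22 (s11 x) = x, d02 (s11 x) = s00 (d01 x) & d12 (s11 x) = x].
Proof.
case: unitr => phi [_ _ hr] phiE; split; last by rewrite -[RHS](hr x) /= phiE.
  by case: (svalP (phi x)); rewrite phiE /= => <-.
by case: (svalP (phi x)); rewrite phiE /= => _ <-.
Qed.

(** The bijection onto the pullback is the identity on left legs, so the
    preimage of a point (x, e, m) can only be x itself; surjectivity then
    determines e and m from x. *)
Lemma unitr_maps_degenerate e m :
  s00 e = d02 m -> e = d01 (d22 m) /\ m = s11 (d22 m).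
Proof.
move=> em; case: unitr => phi [[psi _ psiK] hl _] phiE.
pose P (p : X * E * M) := p.1.1 = d22 p.2 /\ s00 p.1.2 = d02 p.2.
pose p : {p | P p} := exist P (d22 m, e, m) (conj erefl em).
have psip : psi p = d22 m by rewrite -[LHS](hl (psi p)) psiK.
by have := phiE (psi p); rewrite psiK psip => -[].
Qed.

Lemma mult_rel_unitr x e w : mult_rel x (s00 e) w -> e = d01 x /\ w = x.
Proof.
move=> [m /= [<- /esym em] <-].
have [-> ms] := unitr_maps_degenerate em; split=> //.
by rewrite [in LHS]ms; have [_ _] := unitr_maps_faces (d22 m).
Qed.

Lemma mult_rel_unitr_id x : mult_rel x (s00 (d01 x)) x.
Proof.
by have [dx de dw] := unitr_maps_faces x; exists (s11 x); rewrite /= ?dx ?de.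
Qed.

End RightUnit.

Section LeftUnit.

Variables (d11 : X -> E) (s01 : X -> M).
Hypothesis unitl : unitl_maps s00 d02 d12 d22 d11 s01.

Lemma unitl_maps_faces x :
  [/\ d22 (s01 x) = s00 (d11 x), d02 (s01 x) = x & d12 (s01 x) = x].
Proof.
case: unitl => phi [_ _ hr] phiE; split; last by rewrite -[RHS](hr x) /= phiE.
  by case: (svalP (phi x)); rewrite phiE /= => <-.
by case: (svalP (phi x)); rewrite phiE /= => _ <-.
Qed.

Lemma unitl_maps_degenerate e m :
  s00 e = d22 m -> e = d11 (d02 m) /\ m = s01 (d02 m).
Proof.
move=> em; case: unitl => phi [[psi _ psiK] hl _] phiE.
pose P (p : E * X * M) := s00 p.1.1 = d22 p.2 /\ p.1.2 = d02 p.2.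
pose p : {p | P p} := exist P (e, d02 m, m) (conj em erefl).
have psip : psi p = d02 m by rewrite -[LHS](hl (psi p)) psiK.
by have := phiE (psi p); rewrite psiK psip => -[].
Qed.

Lemma mult_rel_unitl e y w : mult_rel (s00 e) y w -> e = d11 y /\ w = y.
Proof.
move=> [m /= [/esym em <-] <-].
have [-> ms] := unitl_maps_degenerate em; split=> //.
by rewrite [in LHS]ms; have [_ _] := unitl_maps_faces (d02 m).
Qed.

Lemma mult_rel_unitl_id y : mult_rel (s00 (d11 y)) y y.
Proof.
by have [de dy dw] := unitl_maps_faces y; exists (s01 y); rewrite /= ?dy ?de.
Qed.

End LeftUnit.

(** * Identities of the left and right unit maps *)

Variables (d01 d11 : X -> E) (s01 s11 : X -> M).
Hypotheses (unitr : unitr_maps s00 d02 d12 d22 d01 s11)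
  (unitl : unitl_maps s00 d02 d12 d22 d11 s01).

(** The product of [s00 e] with its right unit is a product with a unit on
    both sides, so it is equal to both of its factors. *)
Lemma unit_maps_unit e : d01 (s00 e) = e /\ d11 (s00 e) = e.
Proof.
have [er ewr] := mult_rel_unitl unitl (mult_rel_unitr_id unitr (s00 e)).
have [el ewl] := mult_rel_unitr unitr (mult_rel_unitl_id unitl (s00 e)).
by split; [rewrite [RHS]el -ewl | rewrite [RHS]er -ewr].
Qed.

Lemma degeneracy_unit e : s01 (s00 e) = s11 (s00 e).
Proof.
have [d22s d02s _] := unitr_maps_faces unitr (s00 e).
have [_ ->] := unitl_maps_degenerate unitl (esym d22s).
by rewrite d02s (unit_maps_unit e).1.
Qed.

Hypothesis monoid :
  is_monoid (hom_class (unit_span s00)) (hom_class (mult_span d02 d12 d22)).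

(** In (x1)y = x(1y), the unit on the right of x is the one on the left of y. *)
Lemma mult_rel_composable x y w : mult_rel x y w -> d01 x = d11 y.
Proof.
move=> xyw.
have /(mult_rel_assoc _ _ _ _ monoid)[v eyv _] :
    exists2 u, mult_rel x (s00 (d01 x)) u & mult_rel u y w.
  by exists x => //; exact: mult_rel_unitr_id unitr x.
by case: (mult_rel_unitl unitl eyv).
Qed.

(** In x(y1) = (xy)1, the right unit of y becomes one of the product. *)
Lemma mult_rel_right_unit x y w : mult_rel x y w -> d01 w = d01 y.
Proof.
move=> xyw.
have /(mult_rel_assoc _ _ _ _ monoid)[u _ uew] :
    exists2 v, mult_rel y (s00 (d01 y)) v & mult_rel x v w.
  by exists y => //; exact: mult_rel_unitr_id unitr y.
by have [-> ->] := mult_rel_unitr unitr uew.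
Qed.

(** In (1x)y = 1(xy), the left unit of x becomes one of the product. *)
Lemma mult_rel_left_unit x y w : mult_rel x y w -> d11 x = d11 w.
Proof.
move=> xyw.
have /(mult_rel_assoc _ _ _ _ monoid)[v _ evw] :
    exists2 u, mult_rel (s00 (d11 x)) x u & mult_rel u y w.
  by exists x => //; exact: mult_rel_unitl_id unitl x.
by have [-> ->] := mult_rel_unitl unitl evw.
Qed.

End Monoid.

Theorem theorem3p9 (X : Type) (eta : hom unit X) (mu : hom (X * X) X)
    (eta_mu_monoid : is_monoid eta mu)
    (E M : Type) (s00 : E -> X) (d02 d12 d22 : M -> X)
    (eta_repr : eta = hom_class (unit_span s00))
    (mu_repr : mu = hom_class (mult_span d02 d12 d22))
    (d01 d11 : X -> E) (s01 s11 : X -> M)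
    (d01_s11_def : unitr_maps s00 d02 d12 d22 d01 s11)
    (d11_s01_def : unitl_maps s00 d02 d12 d22 d11 s01) :
  is_2truncated_simplicial_set (X0 := E) (X1 := X) (X2 := M)
    d01 d11 d02 d12 d22 s00 s01 s11.
Proof.
subst eta mu; split=> [m|m|m|e|e|e|x|x|x|x|x|x].
- exact: mult_rel_right_unit d01_s11_def eta_mu_monoid _ _ _ (mult_relE _ _ _ m).
- exact: mult_rel_composable d01_s11_def d11_s01_def eta_mu_monoid _ _ _
    (mult_relE _ _ _ m).
- exact: mult_rel_left_unit d11_s01_def eta_mu_monoid _ _ _ (mult_relE _ _ _ m).
- exact: degeneracy_unit d01_s11_def d11_s01_def e.
- by case: (unit_maps_unit d01_s11_def d11_s01_def e).
- by case: (unit_maps_unit d01_s11_def d11_s01_def e).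
- by case: (unitl_maps_faces d11_s01_def x).
- by case: (unitl_maps_faces d11_s01_def x).
- by case: (unitl_maps_faces d11_s01_def x).
- by case: (unitr_maps_faces d01_s11_def x).
- by case: (unitr_maps_faces d01_s11_def x).
- by case: (unitr_maps_faces d01_s11_def x).
Qed.
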